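(* Let $m\ge 2$ and $\epsilon\in(0,1)$. Let $f:\{0,1\}^n\to\{0,1\}$ be a Boolean function that has a linear characteristic polynomial over $\mathbb{Z}_m$, i.e. a polynomial $g=c_1x_1+\dots+c_nx_n+c_0$ with $c_0,\dots,c_n\in\mathbb{Z}_m$ such that for all $\sigma\in\{0,1\}^n$, $g(\sigma)=0$ in $\mathbb{Z}_m$ iff $f(\sigma)=1$. Then $f$ can be computed with one-sided error $\epsilon$ by a quantum OBDD of width $O\left(\frac{\log m}{\epsilon}\right)$.
   Context: A quantum branching program (QBP) over $\mathcal{H}^d=\mathbb{C}^d$ is a triple $Q=\langle T,|\psi_0\rangle,Accept\rangle$ where $|\psi_0\rangle\in\mathcal{H}^d$ is a unit initial state, $Accept\subseteq\{1,\dots,d\}$, and $T$ is a sequence of instructions $T_j=(x_{i_j},U_j(0),U_j(1))$, $j=1,\dots,l$, each consisting of an input variable $x_{i_j}$ and two unitary $d\times d$ matrices. On input $\sigma\in\{0,1\}^n$ the final state is $|\psi_\sigma\rangle=U_l(\sigma_{i_l})\cdots U_1(\sigma_{i_1})|\psi_0\rangle=(\alpha_1,\dots,\alpha_d)^T$ in the standard basis, and $\sigma$ is accepted with probability $\sum_{i\in Accept}|\alpha_i|^2$. The width of $Q$ is $d$. A quantum OBDD (read-once QBP) is a QBP in which each variable $x_1,\dots,x_n$ occurs at most once in the sequence $T$. $Q$ computes $f$ with one-sided error $\epsilon\in(0,1)$ if every $\sigma\in f^{-1}(1)$ is accepted with probability $1$ and every $\sigma\in f^{-1}(0)$ is accepted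 with probability less than $\epsilon$. *)

(* Defs.v *)
From HB Require Import structures.
From mathcomp Require Import all_boot all_order all_algebra.
From mathcomp Require Import spectral complex.
From mathcomp Require Import reals exp.

Set Implicit Arguments.
Unset Strict Implicit.
Unset Printing Implicit Defensive.

Import Order.TTheory GRing.Theory Num.Theory.
Local Open Scope ring_scope.

(* Indices are 0-based: the input variable x_(i+1) is i : 'I_n, and the basis
   state i+1 of C^d is i : 'I_d. *)

Section QuantumBranchingPrograms.
Variables (R : realType) (n d : nat).

Record instruction := Instruction {
  instr_var : 'I_n;
  instr_mx : bool -> 'M[R[i]]_d;
  instr_unitary : forall b : bool, instr_mx b \is unitarymx
}.

(* [ComplexField.Normc.normc] is the R-valued modulus; the generic norm on R[i]
   is R[i]-valued. *)
Definition sqnorm_on (A : {set 'I_d}) (psi : 'cV[R[i]]_d) : R :=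
  \sum_(i in A) ComplexField.Normc.normc (psi i 0) ^+ 2.

(* The head of [qbp_prog] is the instruction that is applied first. *)
Record qbp := Qbp {
  qbp_prog : seq instruction;
  qbp_init : 'cV[R[i]]_d;
  qbp_init_unit : sqnorm_on [set: 'I_d] qbp_init = 1;
  qbp_accept : {set 'I_d}
}.

Definition final_state (Q : qbp) (sigma : n.-tuple bool) : 'cV[R[i]]_d :=
  foldl (fun psi t => instr_mx t (tnth sigma (instr_var t)) *m psi)
    (qbp_init Q) (qbp_prog Q).

Definition accept_prob (Q : qbp) (sigma : n.-tuple bool) : R :=
  sqnorm_on (qbp_accept Q) (final_state Q sigma).

Definition is_qobdd (Q : qbp) : bool :=
  uniq [seq instr_var t | t <- qbp_prog Q].

Definition computes_one_sided (Q : qbp) (eps : R) (f : n.-tuple bool -> bool) :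
    Prop :=
  forall sigma : n.-tuple bool,
    (f sigma = true -> accept_prob Q sigma = 1) /\
    (f sigma = false -> accept_prob Q sigma < eps).

End QuantumBranchingPrograms.

(* 'Z_m is the ring of integers mod m only for 1 < m. *)
Definition linear_poly_eval (m n : nat) (c : 'I_n -> 'Z_m) (c0 : 'Z_m)
    (sigma : n.-tuple bool) : 'Z_m :=
  \sum_(i < n) c i * (tnth sigma i)%:R + c0.

Definition has_linear_char_poly (m n : nat) (f : n.-tuple bool -> bool) : Prop :=
  exists (c : 'I_n -> 'Z_m) (c0 : 'Z_m), forall sigma : n.-tuple bool,
    linear_poly_eval c c0 sigma = 0 <-> f sigma = true.

(* Main.v *)
Require Import Defs.
From HB Require Import structures.
From mathcomp Require Import all_boot all_order all_algebra.
From mathcomp Require Import spectral complex.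
From mathcomp Require Import reals exp.
From mathcomp Require Import cyclic separable cyclotomic sequences ring lra.

Import Order.TTheory GRing.Theory Num.Theory.
Local Open Scope ring_scope.

(** Quantum fingerprinting. Let [w] be a primitive [m]-th root of unity and
   [k_1, ..., k_t] elements of Z_m. Reading [x_i = 1] multiplies the [j]-th
   amplitude of the uniform superposition by [w ^ (k_j c_i)]; the overlap of the
   final state with the uniform superposition is [1/t \sum_j w ^ (k_j g(sigma))],
   which is 1 if [g(sigma) = 0]. For the other values [b] of [g], a union bound
   over [b] gives [k_j] with [t = O(log m / eps)] making all these averages
   smaller than [sqrt eps] in modulus. Conjugating every instruction by the
   discrete Fourier transform turns the overlap into an amplitude without an
   additional (not read-once) last step. *)

(** * Roots of unity and the discrete Fourier transform *)

Section UnityRoots.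
Variable C : numClosedFieldType.

(** In characteristic 0 the polynomial ['X^n - 1] is separable, so it has [n] distinct roots, and
    [n] distinct [n]-th roots of unity include a primitive one. *)
Lemma prim_root_exists n : (0 < n)%N -> exists z : C, n.-primitive_root z.
Proof.
move=> n_gt0; have [r] := closed_field_poly_normal ('X^n - 1 : {poly C}).
rewrite (monicP (monicXnsubC 1 n_gt0)) scale1r => def_r.
have uniq_r : uniq r.
  rewrite -separable_prod_XsubC -def_r separable_Xn_sub_1 //.
  by rewrite pnatr_eq0 -lt0n.
suff /hasP[z _ z_prim] : has n.-primitive_root r by exists z.
apply: has_prim_root => //; last first.
  by rewrite -ltnS -(size_prod_XsubC r id) -def_r size_XnsubC.
by apply/allP => z; rewrite -root_prod_XsubC -def_r.
Qed.

Lemma norm_unity_root n (z : C) : (0 < n)%N -> z ^+ n = 1 -> `|z| = 1.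
Proof.
move=> n_gt0 zn1; apply/eqP; rewrite -(pexpr_eq1 n_gt0) //.
by rewrite -normrX zn1 normr1.
Qed.

Lemma conj_norm1 (z : C) : `|z| = 1 -> z^* = z^-1.
Proof. by move=> z1; rewrite invC_norm z1 expr1n invr1 mul1r. Qed.

Lemma sum_expr_unity_root n (z : C) :
  z ^+ n = 1 -> z != 1 -> \sum_(j < n) z ^+ j = 0.
Proof.
move=> zn1 z1; have /eqP := subrX1 z n.
by rewrite zn1 subrr eq_sym mulf_eq0 subr_eq0 (negPf z1) => /eqP.
Qed.

Definition dft_mx n (z : C) : 'M[C]_n :=
  \matrix_(i, j) (z ^+ (i * j) / sqrtC n%:R).

(** The inner product of rows [i] and [k] is a geometric sum with ratio [z ^+ i / z ^+ k], an [n]-th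
    root of unity that equals 1 only for [i = k]. *)
Lemma dft_unitary n (z : C) : n.-primitive_root z -> dft_mx n z \is unitarymx.
Proof.
move=> z_prim; have n_gt0 := prim_order_gt0 z_prim.
have zn1 := prim_expr_order z_prim.
have z1 := norm_unity_root _ _ n_gt0 zn1.
have z_neq0 : z != 0 by rewrite -normr_eq0 z1 oner_eq0.
have nC_neq0 : n%:R != 0 :> C by rewrite pnatr_eq0 -lt0n.
apply/unitarymxP/matrixP => i k; rewrite !mxE.
pose w := z ^+ i / z ^+ k.
have -> : \sum_j dft_mx n z i j * ((dft_mx n z)^T ^ Num.conj)%sesqui j k
    = (\sum_(j < n) w ^+ j) / n%:R.
  rewrite mulr_suml; apply: eq_bigr => j _; rewrite !mxE.
  rewrite rmorphM fmorphV /= rmorphXn /= conj_norm1 //.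
  rewrite conj_Creal ?ger0_real ?sqrtC_ge0 ?ler0n //.
  rewrite -[X in _ = _ / X](sqrtCK n%:R) /w expr_div_n -!exprM exprVn.
  by rewrite mulrACA -invfM -expr2.
have [ik|ik] := eqVneq i k.
  rewrite /w ik divff ?expf_neq0 //; under eq_bigr do rewrite expr1n.
  by rewrite sumr_const card_ord divff.
rewrite sum_expr_unity_root ?mul0r //.
  by rewrite /w expr_div_n -!exprM !(mulnC _ n) !exprM zn1 !expr1n divr1.
apply: contra ik => /eqP w1; have : z ^+ i == z ^+ k.
  by rewrite -[z ^+ i](divfK (expf_neq0 k z_neq0)) -/w w1 mul1r.
by rewrite (eq_prim_root_expr z_prim) !modn_small.
Qed.

Lemma unitary_diag_mx n (d : 'rV[C]_n) :
  (forall j, `|d 0 j| = 1) -> diag_mx d \is unitarymx.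
Proof.
move=> d1; apply/unitarymxP; rewrite tr_diag_mx map_diag_mx mulmx_diag.
rewrite -diag_const_mx; congr diag_mx; apply/rowP => j; rewrite !mxE.
by rewrite -normCK d1 expr1n.
Qed.

End UnityRoots.

(** * Additive characters of Z_m *)

Section Characters.
Variables (C : numClosedFieldType) (m : nat) (w : C).
Hypotheses (m_gt1 : (1 < m)%N) (w_prim : m.-primitive_root w).

Definition chi (a : 'Z_m) : C := w ^+ a.

Lemma chi0 : chi 0 = 1. Proof. by []. Qed.

Lemma chiD a b : chi (a + b) = chi a * chi b.
Proof.
rewrite /chi -exprD -[RHS](prim_expr_mod w_prim) /=.
by rewrite [X in (_ %% X)%N]Zp_cast.
Qed.

Lemma norm_chi a : `|chi a| = 1.
Proof.
rewrite normrX (norm_unity_root _ m) ?expr1n ?(ltnW m_gt1) //.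
exact: prim_expr_order.
Qed.

Lemma chi_eq1 a : (chi a == 1) = (a == 0).
Proof.
rewrite /chi -[1](expr0 w) (eq_prim_root_expr w_prim) mod0n modn_small //.
by have := ltn_ord a; rewrite [X in (_ < X)%N]Zp_cast.
Qed.

(** Shifting the summation variable by 1 multiplies the sum by [chi b], which differs from 1. *)
Lemma sum_chi b : b != 0 -> \sum_a chi (a * b) = 0.
Proof.
move=> b_neq0; set S := \sum_a _.
suff /eqP: (chi b - 1) * S = 0.
  by rewrite mulf_eq0 subr_eq0 chi_eq1 (negPf b_neq0) => /eqP.
rewrite mulrBl mul1r {2}/S (reindex_inj (addrI 1)) /= mulr_sumr.
apply/eqP; rewrite subr_eq0; apply/eqP/eq_bigr => a _.
by rewrite mulrDl mul1r chiD.
Qed.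

End Characters.

(** * An exponential-moment sampling argument *)

Section Sampling.
Variable R : realType.

(** With [u = y - 2 * y ^+ 2], the bound [expR (- u) >= 1 - u] reduces the claim to
    [(1 - u) * (1 + y) >= 1]. *)
Lemma expR_sub2sqr_le (y : R) : - 2^-1 <= y -> expR (y - 2 * y ^+ 2) <= 1 + y.
Proof.
move=> y_ge.
have -> : 1 + y = expR (y - 2 * y ^+ 2) * (expR (- (y - 2 * y ^+ 2)) * (1 + y)).
  by rewrite mulrA expRxMexpNx_1 mul1r.
rewrite ler_peMr ?expR_ge0 //.
have := expR_ge1Dx (- (y - 2 * y ^+ 2)); set e := expR _ => e_ge.
apply: (@le_trans _ _ ((1 - (y - 2 * y ^+ 2)) * (1 + y))); last first.
  by rewrite ler_wpM2r //; lra.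
have -> : (1 - (y - 2 * y ^+ 2)) * (1 + y) = 1 + y ^+ 2 * (1 + 2 * y) by ring.
by rewrite lerDl mulr_ge0 ?sqr_ge0 //; lra.
Qed.

(* A uniformly random [k] gives each product [\prod_j (1 + l * x w (k j))]
   expectation exactly 1, so some [k] keeps the sum of all of them below [#|W|]. *)
Lemma balanced_sample (I W : finType) (P : pred W) (x : W -> I -> R) (l : R)
    (t : nat) :
  (0 < #|I|)%N ->
  (forall w i, `|x w i| <= 1) -> (forall w, P w -> \sum_i x w i = 0) ->
  0 <= l <= 2^-1 ->
  exists k : {ffun 'I_t -> I}, forall w, P w ->
    l * \sum_j x w (k j) <= 2 * l ^+ 2 * t%:R + ln #|W|%:R.
Proof.
move=> I_gt0 x_le1 x_sum0 /andP[l_ge0 l_le].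
have lx_ge w i : - 2^-1 <= l * x w i.
  have /andP[x_ge x_le] : -1 <= x w i <= 1 by rewrite -ler_norml.
  by nra.
have prod_ge0 w (k : {ffun 'I_t -> I}) : 0 <= \prod_j (1 + l * x w (k j)).
  by apply: prodr_ge0 => j _; have := lx_ge w (k j); lra.
pose S (k : {ffun 'I_t -> I}) := \sum_(w | P w) \prod_j (1 + l * x w (k j)).
have sumS : \sum_k S k = \sum_(k : {ffun 'I_t -> I}) (\sum_(w | P w) 1).
  rewrite exchange_big [RHS]exchange_big /=; apply: eq_bigr => w Pw.
  (* The coordinates of [k] are independent, so the sum over all [k] is the [t]-th power of a sum
     over [I], in which the linear term vanishes. *)
  rewrite -(bigA_distr_bigA (fun _ i => 1 + l * x w i)) /=.
  have -> : \sum_i (1 + l * x w i) = #|I|%:R.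
    by rewrite big_split /= -mulr_sumr x_sum0 // mulr0 addr0 sumr_const.
  by rewrite prodr_const sumr_const card_ord card_ffun card_ord natrX.
have [k Sk] : exists k, S k <= \sum_(w | P w) 1.
  apply/existsP; rewrite -[X in is_true X]negbK negb_exists.
  apply/negP => /forallP S_gt.
  (* A strict inequality between the sums requires at least one function [k], here the constant
     one. *)
  have /card_gt0P[i0 _] := I_gt0.
  suff : \sum_k S k > \sum_(k : {ffun 'I_t -> I}) (\sum_(w | P w) 1).
    by rewrite sumS ltxx.
  apply: ltr_sum => [|k _]; last by rewrite ltNge.
  by apply/hasP; exists [ffun=> i0]; rewrite ?mem_index_enum.
exists k => w Pw; have W_gt0 : (0 < #|W|)%N by apply/card_gt0P; exists w.
rewrite -lerBlDl -ler_expR lnK ?posrE ?ltr0n //.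
have -> : l * \sum_j x w (k j) - 2 * l ^+ 2 * t%:R
    = \sum_j (l * x w (k j) - 2 * l ^+ 2).
  by rewrite big_split /= sumr_const card_ord mulr_sumr mulr_natr mulNrn.
rewrite expR_sum; apply: (@le_trans _ _ (\prod_j (1 + l * x w (k j)))).
  apply: ler_prod => j _; rewrite expR_ge0 /=.
  apply: le_trans (expR_sub2sqr_le _ (lx_ge w (k j))).
  rewrite ler_expR lerD2l lerN2 ler_pM2l ?ltr0n // exprMn.
  by rewrite ler_piMr ?sqr_ge0 // -real_normK ?num_real // expr_le1.
apply: (@le_trans _ _ (S k)); first by rewrite /S (bigD1 w) //= lerDl sumr_ge0.
by apply: le_trans Sk _; rewrite sumr_const ler_nat max_card.
Qed.

End Sampling.

(** * Multipliers with small character sums *)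

Section Fingerprints.
Variable R : realType.
Local Notation normc := ComplexField.Normc.normc.
Local Notation Re := complex.Re.
Local Notation Im := complex.Im.

Lemma normc_sqr (z : R[i]) : normc z ^+ 2 = Re z ^+ 2 + Im z ^+ 2.
Proof. by case: z => a b /=; rewrite sqr_sqrtr // addr_ge0 ?sqr_ge0. Qed.

Lemma normc_norm (z : R[i]) : `|z| = (normc z)%:C%C.
Proof. by []. Qed.

Lemma normc_sqrC (z : R[i]) : (normc z ^+ 2)%:C%C = `|z| ^+ 2.
Proof. by rewrite normc_norm rmorphXn. Qed.

(** Real and imaginary parts, each with both signs, give [4 * m] real-valued families to control at
    once, whence [ln (4 * m%:R)]. *)
Lemma separating_sample (m t : nat) (w : R[i]) (eps : R) :
  (1 < m)%N -> m.-primitive_root w -> 0 < eps -> eps < 1 ->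
  32 * ln (4 * m%:R) / eps <= t%:R -> (0 < t)%N ->
  exists k : {ffun 'I_t -> 'Z_m}, forall b, b != 0 ->
    normc (\sum_j chi _ m w (k j * b)) ^+ 2 < eps * t%:R ^+ 2.
Proof.
move=> m_gt1 w_prim eps_gt0 eps_lt1 t_ge t_gt0.
pose x (v : 'Z_m * bool * bool) (a : 'Z_m) : R :=
  let z := chi _ m w (a * v.1.1) in
  (-1) ^+ v.1.2 * (if v.2 then Re z else Im z).
pose s := Num.sqrt eps.
have s_gt0 : 0 < s by rewrite sqrtr_gt0.
have s2 : s ^+ 2 = eps by rewrite sqr_sqrtr // ltW.
have s_lt1 : s < 1 by rewrite -sqrtr1 ltr_sqrt.
have card_Zm : #|{: 'Z_m}| = m by rewrite card_ord Zp_cast.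
have [||v|/=|k kP] := @balanced_sample R _ _ (fun v => v.1.1 != 0) x (s / 8) t.
- by rewrite card_Zm ltnW.
- move=> v a; rewrite normrM normrX normrN1 expr1n mul1r.
  have := norm_chi _ m w m_gt1 w_prim (a * v.1.1).
  set z := chi _ _ _ _ => z1.
  have z2 : Re z ^+ 2 + Im z ^+ 2 = 1.
    by rewrite -normc_sqr; move: z1; rewrite normc_norm => -[->]; rewrite expr1n.
  have bound (y : R) : y ^+ 2 <= 1 -> `|y| <= 1.
    by move=> y2; rewrite -(expr_le1 (n := 2)) // real_normK ?num_real.
  case: ifP => _; apply: bound; rewrite -z2.
    by rewrite lerDl sqr_ge0.
  by rewrite lerDr sqr_ge0.
- move=> v_neq0; rewrite /x /= -mulr_sumr.
  have := sum_chi _ m w m_gt1 w_prim v.1.1 v_neq0.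
  by case: v.2; rewrite -!raddf_sum => -> /=; rewrite mulr0.
- by lra.
exists k => b b_neq0; set z := \sum_j _.
pose B := s * t%:R / 2.
have T_gt0 : 0 < t%:R :> R by rewrite ltr0n.
have key (g c : bool) : (-1) ^+ g * (if c then Re z else Im z) <= B.
  have := kP (b, g, c) b_neq0; rewrite /x /= -mulr_sumr.
  have -> : \sum_j (if c then Re (chi _ m w (k j * b))
                    else Im (chi _ m w (k j * b)))
      = (if c then Re z else Im z) by case: c; rewrite -raddf_sum.
  rewrite !card_prod card_Zm card_bool -mulnA natrM [m%:R * _]mulrC => le1.
  move: t_ge; rewrite ler_pdivrMr // => t_ge.
  rewrite -(ler_pM2l (_ : 0 < s / 8)); last by lra.
  apply: le_trans le1 _; rewrite /B.
  have -> : (2 * 2)%:R = 4 :> R by [].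
  by move: t_ge; rewrite -s2; lra.
have sq_le (y : R) : y <= B -> - y <= B -> y ^+ 2 <= B ^+ 2.
  move=> y1 y2; rewrite -[y ^+ 2]real_normK ?num_real // lerXn2r ?nnegrE //.
    by rewrite /B; nra.
  by rewrite ler_norml y1 andbT lerNl.
rewrite normc_sqr; apply: (@le_lt_trans _ _ (B ^+ 2 + B ^+ 2)).
  move: (key true true) (key true false) (key false true) (key false false).
  rewrite /= !expr0 !expr1 !mulN1r !mul1r => *.
  by apply: lerD; apply: sq_le.
(* Twice [B ^+ 2] is half of [eps * t%:R ^+ 2], so the inequality is strict. *)
have : 0 < (s * t%:R) ^+ 2 by rewrite exprn_gt0 ?mulr_gt0.
by rewrite /B -s2; lra.
Qed.

End Fingerprints.

(** * The read-once program *)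

Section FingerprintProgram.
Variables (R : realType) (m n t : nat) (w z : R[i]) (k : 'I_t.+1 -> 'Z_m).
Variables (c : 'I_n -> 'Z_m) (c0 : 'Z_m).
Hypotheses (m_gt1 : (1 < m)%N) (w_prim : m.-primitive_root w).
Hypothesis z_prim : t.+1.-primitive_root z.
Local Notation normc := ComplexField.Normc.normc.
Local Notation U := (dft_mx R[i] t.+1 z).

Definition phase_mx (a : 'Z_m) : 'M[R[i]]_t.+1 :=
  U *m diag_mx (\row_j chi _ m w (k j * a)) *m (U ^t Num.conj)%sesqui.

Lemma phase_unitary a : phase_mx a \is unitarymx.
Proof.
have U_unitary : U \is unitarymx by exact: dft_unitary.
apply: mul_unitarymx; last by rewrite trmxC_unitary.
apply: mul_unitarymx; first exact: U_unitary.
by apply: unitary_diag_mx => j; rewrite mxE norm_chi.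
Qed.

(** The inner factors cancel, so a whole run collapses to one [phase_mx] at the sum of the
    arguments. *)
Lemma phaseD a b : phase_mx a *m phase_mx b = phase_mx (b + a).
Proof.
have U_unitary : U \is unitarymx by exact: dft_unitary.
have /mulmx1C := unitarymxP U_unitary; rewrite /phase_mx.
move: (U ^t Num.conj)%sesqui => V VU; rewrite -!mulmxA (mulmxA V) VU mul1mx.
rewrite (mulmxA (diag_mx _)) mulmx_diag; congr (_ *m (diag_mx _ *m _)).
apply/rowP => j; rewrite !mxE.
by rewrite mulrDr chiD // mulrC.
Qed.

Lemma phase0 : phase_mx 0 = 1%:M.
Proof.
rewrite /phase_mx.
have -> : \row_j chi _ m w (k j * 0) = const_mx 1.
  by apply/rowP => j; rewrite !mxE mulr0 chi0.
by rewrite diag_const_mx mulmx1; apply/unitarymxP/dft_unitary.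
Qed.

(** Row 0 of the Fourier matrix is constant, so this entry is the overlap of the phase-shifted
    uniform superposition with the unshifted one. *)
Lemma phase00 a : phase_mx a 0 0 = (\sum_j chi _ m w (k j * a)) / t.+1%:R.
Proof.
rewrite mxE mulr_suml; apply: eq_bigr => j _.
rewrite mul_mx_diag !mxE mul0n expr0.
rewrite div1r fmorphV /= conj_Creal ?ger0_real ?sqrtC_ge0 ?ler0n //.
by rewrite mulrAC -invfM -expr2 sqrtCK mulrC.
Qed.

Definition phase_instr (i : 'I_n) : instruction R n t.+1 :=
  Instruction i (fun b => phase_unitary (c i * b%:R)).

(** The constant term belongs to no variable and is put into the initial state, which is a column of
    a unitary matrix. *)
Lemma phase_init_unit :
  sqnorm_on [set: 'I_t.+1] (phase_mx c0 *m delta_mx 0 0) = 1.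
Proof.
have : (phase_mx c0)^T \is unitarymx by rewrite trmx_unitary phase_unitary.
move/unitarymxP/matrixP => /(_ 0 0); rewrite !mxE eqxx => P1.
apply: (@complexI R); rewrite rmorph1 -[RHS]P1 rmorph_sum big_mkcond /=.
by apply: eq_bigr => j _; rewrite inE normc_sqrC normCK -colE !mxE.
Qed.

Definition phase_qbp : qbp R n t.+1 :=
  Qbp [seq phase_instr i | i <- enum 'I_n] phase_init_unit [set 0].

Lemma phase_qobdd : is_qobdd phase_qbp.
Proof. by rewrite /is_qobdd /= -map_comp map_id enum_uniq. Qed.

Lemma phase_final_state sigma :
  final_state phase_qbp sigma
    = phase_mx (linear_poly_eval c c0 sigma) *m delta_mx 0 0.
Proof.
rewrite /final_state /linear_poly_eval /= -big_enum /=.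
(* Generalizing over [c0] lets each instruction read be absorbed into the constant term. *)
elim: (enum 'I_n) c0 => [|i s IHs] a /=; first by rewrite big_nil add0r.
rewrite mulmxA phaseD big_cons.
by rewrite -addrA addrCA (addrC _ a); exact: IHs.
Qed.

Lemma phase_accept_prob sigma :
  accept_prob phase_qbp sigma
    = normc (phase_mx (linear_poly_eval c c0 sigma) 0 0) ^+ 2.
Proof.
by rewrite /accept_prob /sqnorm_on big_set1 phase_final_state -colE mxE.
Qed.

End FingerprintProgram.

Theorem theorem2 (R : realType) :
  exists C : R, 0 < C /\
    forall (m n : nat) (eps : R) (f : n.-tuple bool -> bool),
      (2 <= m)%N -> 0 < eps -> eps < 1 ->
      has_linear_char_poly m f ->
      exists (d : nat) (Q : qbp R n d),
        [/\ d%:R <= C * (ln m%:R / eps),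
            is_qobdd Q
          & computes_one_sided Q eps f].
Proof.
(* Since [ln 4 <= 2 * ln m], [T] is at most [96 * ln m / eps]; rounding up adds at most 1, which is
   below [2 * ln m / eps] because [ln m >= 2^-1] and [eps < 1]. *)
exists 98; split=> [|m n eps f m_gt1 eps_gt0 eps_lt1 [c [c0 cP]]]; first by [].
pose T := 32 * ln (4 * m%:R) / eps; pose t := Num.truncn T.
have m_ge2 : 2 <= m%:R :> R by rewrite ler_nat.
have ln2_ge : 2^-1 <= ln 2 :> R.
  (* It suffices that [expR 2^-1 <= 2], which follows from [expR (- 2^-1) >= 1 - 2^-1]. *)
  rewrite -[2^-1]expRK ler_ln ?posrE ?expR_gt0 //.
  have := expRxMexpNx_1 (2^-1 : R); have := expR_ge1Dx (- 2^-1 : R).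
  by have := expR_gt0 (2^-1 : R); nra.
have lnm_ge : ln 2 <= ln m%:R :> R by rewrite ler_ln ?posrE //; lra.
have ln4m : ln (4 * m%:R) = 2 * ln 2 + ln m%:R :> R.
  have -> : 4 = 2 * 2 :> R by ring.
  by rewrite !lnM ?posrE ?mulr_gt0 //; lra.
have T_ge0 : 0 <= T by apply: divr_ge0; [lra | exact: ltW].
have /andP[T_ge T_lt] : t%:R <= T < t.+1%:R by exact: truncn_itv.
have [w w_prim] := prim_root_exists R[i] m (ltnW m_gt1).
have [z z_prim] := prim_root_exists R[i] t.+1 isT.
have [k kP] := separating_sample R m t.+1 w eps m_gt1 w_prim eps_gt0 eps_lt1
  (ltW T_lt) isT.
exists t.+1, (phase_qbp R m n t w z k c c0 m_gt1 w_prim z_prim); split.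
- rewrite -natr1; have -> : 98 * (ln m%:R / eps)
      = 96 * ln m%:R / eps + 2 * ln m%:R / eps.
    by field; rewrite gt_eqF.
  apply: lerD; last by rewrite ler_pdivlMr //; lra.
  by apply: le_trans T_ge _; rewrite ler_pM2r ?invr_gt0 //; lra.
- exact: phase_qobdd.
move=> sigma; rewrite phase_accept_prob; split=> [/cP -> | f0].
  by rewrite phase0 // mxE eqxx ComplexField.Normc.normc1 expr1n.
have /kP : linear_poly_eval c c0 sigma != 0.
  by apply/eqP => /cP; rewrite f0.
rewrite phase00 ComplexField.Normc.normcM ComplexField.Normc.normcV exprMn exprVn.
have -> : ComplexField.Normc.normc (t.+1%:R : R[i]) = t.+1%:R.
  by apply: (@complexI R); rewrite -normc_norm normr_nat rmorph_nat.
by rewrite ltr_pdivrMr // exprn_gt0 // ltr0n.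
Qed.
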